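(* The $t$-leading desingularisation algorithm described in the context is correct and terminates. That is, for every regular input matrix $A\in\mathbb{K}[t,\sigma]^{m\times m}$ it stops after finitely many steps and returns a matrix $B\in\mathbb{K}[t,\sigma]^{m\times m}$ that is equivalent to $A$ and whose $t$-leading matrix is regular.
   Context: **Setting.** $\mathbb{K}$ is a field of characteristic $0$, $q\in\mathbb{K}\setminus\{0\}$ is not a root of unity, and $t$ is an indeterminate over $\mathbb{K}$. $\mathbb{K}[t,\sigma]$ is the ring of skew polynomials in $\sigma$ with coefficients in $\mathbb{K}[t]$ (written on the left), with the usual addition and with multiplication governed by $\sigma t=qt\sigma$, where $\sigma$ commutes with the elements of $\mathbb{K}$. $\mathbb{K}(t)[\sigma]\supseteq\mathbb{K}[t,\sigma]$ is the analogous ring with coefficients in $\mathbb{K}(t)$ (so $\sigma t^{-1}=q^{-1}t^{-1}\sigma$). The subring $\mathbb{K}[\sigma]$ may be regarded as an ordinary commutative univariate polynomial ring. $\mathrm{GL}_m(R)$ denotes the set of unimodular matrices over $R$, i.e. matrices in $R^{m\times m}$ having an inverse in $R^{m\times m}$. A matrix in $\mathbb{K}[t,\sigma]^{m\times m}$ is regular if it has full left row rank over $\mathbb{K}(t)[\sigma]$ (its rows are left linearly independent); a matrix in $\mathbb{K}[\sigma]^{m\times m}$ is regular if it has full rank over $\mathbb{K}[\sigma]$, i.e. nonzero determinant. Two matrices $A,B$ are equivalent if $B=UA$ for some $U\in\mathrm{GL}_m(\mathbb{K}(t)[\sigma])$. **$t$-leading matrix.** A nonzero $A\in\mathbb{K}[t,\sigma]^{m\times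 m}$ is written as $A=t^\ell\tilde A_\ell+\ldots+t\tilde A_1+\tilde A_0$ with $\tilde A_0,\ldots,\tilde A_\ell\in\mathbb{K}[\sigma]^{m\times m}$ and $\tilde A_\ell\neq\mathbf{0}$; then $\tilde A_\ell$ is called the $t$-leading matrix of $A$. **Popov normal form.** Let $e_i$ be the $i$-th unit row vector. The term over position ordering on $\mathbb{K}[\sigma]^{1\times m}$ is: $e_i\sigma^a\leq e_j\sigma^b$ if $a<b$, or $a=b$ and $i\geq j$. A matrix over $\mathbb{K}[\sigma]$ is in Popov normal form if its rows form a minimal Gröbner basis with respect to this ordering; such a matrix has maximal row rank. For every $M\in\mathbb{K}[\sigma]^{m\times m}$ there is a transformation matrix $X\in\mathrm{GL}_m(\mathbb{K}[\sigma])$ such that $XM=\begin{pmatrix}P\\ \mathbf{0}\end{pmatrix}$ with $P$ in Popov normal form, called the Popov normal form of $M$. Gröbner basis division of the rows of a matrix $C$ by the rows of $P$ gives $C=XP+Y$ with matrices $X,Y$ over $\mathbb{K}[\sigma]$ of suitable sizes such that no row of $Y$ is reducible by $P$. **Algorithm.** Input: a regular matrix $A\in\mathbb{K}[t,\sigma]^{m\times m}$. Output: an equivalent matrix $B\in\mathbb{K}[t,\sigma]^{m\times m}$ such that the $t$-leading matrix of $B$ is regular. 1. Compute the $t$-leading matrix $\tilde A_\ell$ of $A$. If $\det\tilde A_\ell\neq 0$, then return $A$. 2. Else, compute the Popov normal form of $\tilde A_\ell$, let $X\in\mathrm{GL}_m(\mathbb{K}[\sigma])$ be the corresponding transformation matrix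 and let $r$ be the rank of $\tilde A_\ell$. Set $A\leftarrow XA$ and write the new $t$-leading matrix of $A$ as $\tilde A_\ell=\begin{pmatrix}\tilde B_\ell\\ \mathbf{0}\end{pmatrix}$ where $\tilde B_\ell\in\mathbb{K}[\sigma]^{r\times m}$ is in Popov normal form. 3. Let $T=\mathrm{diag}(\mathbf{1}_r,\,t\,\mathbf{1}_{m-r})$, where $\mathbf{1}_k$ is the $k\times k$ identity matrix, and set $A\leftarrow TA$ (this shifts the lower $m-r$ rows of $A$ by $t$). The new $t$-leading matrix is now $\tilde A_\ell=\begin{pmatrix}\tilde B_\ell\\ \tilde C_\ell\end{pmatrix}$ with the same $\tilde B_\ell$ as before and some $\tilde C_\ell\in\mathbb{K}[\sigma]^{(m-r)\times m}$. 4. Use Gröbner basis reduction of $\tilde C_\ell$ by $\tilde B_\ell$, trying to eliminate all the rows in $\tilde C_\ell$. Write the result as $\tilde C_\ell=X\tilde B_\ell+Y$ with $X\in\mathbb{K}[\sigma]^{(m-r)\times r}$ and $Y\in\mathbb{K}[\sigma]^{(m-r)\times m}$. Let $Q=\begin{pmatrix}\mathbf{1}_r&\mathbf{0}\\-X&\mathbf{1}_{m-r}\end{pmatrix}$ and set $A\leftarrow QA$. 5. If $Y=\mathbf{0}$, then continue the inner loop with step 3. Else, go back to the outer loop in step 1.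
   Formalization: In steps 2 and 4, A is multiplied by t^ℓXt^{-ℓ} and t^ℓQt^{-ℓ} (ℓ the t-degree of A) instead of X and Q, since the literal products do not have the asserted t-leading matrices when σt=qtσ and t is written on the left. *)

(* Defs.v *)
From HB Require Import structures.
From mathcomp Require Import all_boot all_order all_algebra.
From mathcomp Require Import generic_quotient fraction.
From Stdlib Require Import Relation_Operators.

Set Implicit Arguments.
Unset Strict Implicit.
Unset Printing Implicit Defensive.

Import GRing.Theory.
Local Open Scope ring_scope.

(* Skew polynomials sum_i a_i sigma^i with coefficients on the left and
   sigma a = s(a) sigma, stored as the polynomial with coefficients a_i. *)
Definition skewpoly (R : nzRingType) (s : {rmorphism R -> R}) : Type := {poly R}.

Section SkewPoly.
Variables (R : nzRingType) (s : {rmorphism R -> R}).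

(* left multiplication by sigma *)
Definition sigma_mul (b : {poly R}) : {poly R} := map_poly s b * 'X.

Definition skew_mul (a b : {poly R}) : {poly R} :=
  \sum_(i < size a) a`_i *: iter i sigma_mul b.

Lemma sigma_mulD : {morph sigma_mul : a b / a + b}.
Proof. by move=> a b; rewrite /sigma_mul rmorphD mulrDl. Qed.

Lemma sigma_mulZ c a : sigma_mul (c *: a) = s c *: sigma_mul a.
Proof. by rewrite /sigma_mul map_polyZ -scalerAl. Qed.

Lemma sigma_mul0 : sigma_mul 0 = 0.
Proof. by rewrite /sigma_mul rmorph0 mul0r. Qed.

Lemma sigma_mul_sum (I : Type) (r : seq I) (F : I -> {poly R}) :
  sigma_mul (\sum_(i <- r) F i) = \sum_(i <- r) sigma_mul (F i).
Proof. exact: (big_morph _ sigma_mulD sigma_mul0). Qed.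

Lemma iter_sigma_mulD n (a b : {poly R}) :
  iter n sigma_mul (a + b) = iter n sigma_mul a + iter n sigma_mul b.
Proof. by elim: n => //= n ->; rewrite sigma_mulD. Qed.

Lemma skew_mul_widen n (a b : {poly R}) : (size a <= n)%N ->
  skew_mul a b = \sum_(i < n) a`_i *: iter i sigma_mul b.
Proof.
move=> le_an; rewrite /skew_mul (big_ord_widen n (fun i => a`_i *: iter i _ b)) //.
rewrite big_mkcond /=; apply: eq_bigr => i _; case: ltnP => // le_ai.
by rewrite nth_default // scale0r.
Qed.

Lemma skew_mulDl : left_distributive skew_mul +%R.
Proof.
move=> a b c; pose n := maxn (size a) (size b).
rewrite (@skew_mul_widen n (a + b)) ?size_polyD //.
rewrite (@skew_mul_widen n a) ?leq_maxl // (@skew_mul_widen n b) ?leq_maxr //.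
by rewrite -big_split; apply: eq_bigr => i _; rewrite coefD scalerDl.
Qed.

Lemma skew_mulDr : right_distributive skew_mul +%R.
Proof.
move=> a b c; rewrite -big_split; apply: eq_bigr => i _.
by rewrite iter_sigma_mulD scalerDr.
Qed.

Lemma skew_mul0 b : skew_mul 0 b = 0.
Proof. by rewrite /skew_mul size_poly0 big_ord0. Qed.

Lemma skew_mulZ c (a b : {poly R}) : skew_mul (c *: a) b = c *: skew_mul a b.
Proof.
rewrite (@skew_mul_widen (size a)) ?size_scale_leq // scaler_sumr.
by apply: eq_bigr => i _; rewrite coefZ scalerA.
Qed.

Lemma skew_mul_sigma (a b : {poly R}) : skew_mul (sigma_mul a) b = sigma_mul (skew_mul a b).
Proof.
rewrite (@skew_mul_widen (size a).+1); last first.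
  by rewrite (leq_trans (size_polyMleq _ _)) // size_polyX addn2 /= ltnS size_poly.
rewrite big_ord_recl coefMX eqxx scale0r add0r sigma_mul_sum.
by apply: eq_bigr => i _; rewrite coefMX /= coef_map sigma_mulZ.
Qed.

Lemma skew_mulA : associative skew_mul.
Proof.
move=> a b c.
have iterE n : skew_mul (iter n sigma_mul b) c = iter n sigma_mul (skew_mul b c).
  by elim: n => //= n IHn; rewrite skew_mul_sigma IHn.
have sumE (I : Type) (r : seq I) (F : I -> {poly R}) :
    skew_mul (\sum_(i <- r) F i) c = \sum_(i <- r) skew_mul (F i) c.
  by apply: (big_morph (skew_mul^~ c)) => [x y|]; rewrite ?skew_mulDl ?skew_mul0.
rewrite {1}/skew_mul [skew_mul a b]/skew_mul sumE.
by apply: eq_bigr => i _; rewrite skew_mulZ iterE.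
Qed.

Lemma skew_mul1l : left_id 1 skew_mul.
Proof.
by move=> a; rewrite /skew_mul size_poly1 big_ord1 coef1 scale1r.
Qed.

Lemma iter_sigma_mul1 n : iter n sigma_mul 1 = 'X^n.
Proof.
by elim: n => //= n ->; rewrite /sigma_mul map_polyXn exprSr.
Qed.

Lemma skew_mul1r : right_id 1 skew_mul.
Proof.
move=> a; rewrite /skew_mul -[RHS]coefK poly_def.
by apply: eq_bigr => i _; rewrite iter_sigma_mul1.
Qed.

HB.instance Definition _ := GRing.Zmodule.copy (skewpoly s) {poly R}.
HB.instance Definition _ := GRing.Zmodule_isNzRing.Build (skewpoly s)
  skew_mulA skew_mul1l skew_mul1r skew_mulDl skew_mulDr (oner_neq0 {poly R}).

Lemma skew_mulE (a b : skewpoly s) : a * b = skew_mul a b.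
Proof. by []. Qed.

(* sigma c = s(c) sigma *)
Lemma skew_sigmaC (c : R) :
  let sigma : skewpoly s := 'X in
  let const a : skewpoly s := a%:P in
  sigma * const c = const (s c) * sigma.
Proof.
rewrite /= !skew_mulE (@skew_mul_widen 2) ?size_polyX //.
rewrite (@skew_mul_widen 1) ?size_polyC_leq1 //.
rewrite big_ord_recl !big_ord1 /= /sigma_mul !coefX coefC scale0r add0r scale1r.
by rewrite map_polyC mul_polyC.
Qed.

End SkewPoly.

Section FractionMap.
Local Open Scope quotient_scope.
Variables (R : idomainType) (f : {rmorphism R -> R}) (f_inj : injective f).
Local Notation tofrac := (@tofrac R).

(* the extension of an injective endomorphism to the field of fractions *)
Definition fraction_map of injective f := fun x : {fraction R} =>
  tofrac (f \n_(repr x)) / tofrac (f \d_(repr x)).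
Local Notation fm := (fraction_map f_inj).

Lemma rmorph_inj_neq0 x : x != 0 -> f x != 0.
Proof. by rewrite -(inj_eq f_inj) rmorph0. Qed.

Lemma fraction_numden (x : {fraction R}) :
  x = tofrac \n_(repr x) / tofrac \d_(repr x).
Proof.
have nz_d := denom_ratioP (repr x).
rewrite -[LHS](mulfK (x := tofrac \d_(repr x))) ?tofrac_eq0 //; congr (_ / _).
rewrite -{1}[x]reprK; unlock FracField.tofrac; rewrite -[LHS]FracField.pi_mul.
rewrite /FracField.mulf !numden_Ratio ?oner_neq0 // mulr1; apply/eqmodP.
by rewrite /= FracField.equivfE !numden_Ratio ?oner_neq0 // mulr1 mulrC.
Qed.

Lemma fraction_mapE a b : b != 0 ->
  fm (tofrac a / tofrac b) = tofrac (f a) / tofrac (f b).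
Proof.
move=> nz_b; rewrite /fraction_map; set x := tofrac a / tofrac b.
move: (fraction_numden x) (denom_ratioP (repr x)).
move: \n_(repr x) \d_(repr x) => n d; rewrite {}/x => /eqP eq_x nz_d.
have nzF y : y != 0 -> tofrac y != 0 by rewrite tofrac_eq0.
move: eq_x; rewrite eqr_div ?nzF // -!rmorphM tofrac_eq => /eqP eq_ab.
by apply/eqP; rewrite eqr_div ?nzF ?rmorph_inj_neq0 // -!rmorphM eq_ab.
Qed.

Lemma fraction_map_tofrac a : fm (tofrac a) = tofrac (f a).
Proof.
by have := @fraction_mapE a 1 (oner_neq0 _); rewrite rmorph1 tofrac1 !divr1.
Qed.

Lemma fraction_map_is_zmod_morphism : zmod_morphism fm.
Proof.
move=> x y; rewrite (fraction_numden x) (fraction_numden y).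
move: (denom_ratioP (repr x)) (denom_ratioP (repr y)).
move: \n_(repr x) \d_(repr x) \n_(repr y) \d_(repr y) => a b c d nz_b nz_d.
have nzF z : z != 0 -> tofrac z != 0 by rewrite tofrac_eq0.
rewrite -mulNr addf_div ?nzF // -rmorphN -!rmorphM -rmorphD.
rewrite !fraction_mapE ?mulf_neq0 // -mulNr addf_div ?nzF ?rmorph_inj_neq0 //.
by rewrite -rmorphN -!rmorphM -rmorphD !(rmorphM, rmorphD, rmorphN).
Qed.

Lemma fraction_map_is_monoid_morphism : monoid_morphism fm.
Proof.
split=> [|x y]; first by rewrite -[X in fm X]tofrac1 fraction_map_tofrac rmorph1 tofrac1.
rewrite (fraction_numden x) (fraction_numden y).
move: (denom_ratioP (repr x)) (denom_ratioP (repr y)).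
move: \n_(repr x) \d_(repr x) \n_(repr y) \d_(repr y) => a b c d nz_b nz_d.
rewrite mulf_div -!rmorphM !fraction_mapE ?mulf_neq0 // mulf_div.
by rewrite !rmorphM.
Qed.

HB.instance Definition _ := GRing.isZmodMorphism.Build {fraction R} {fraction R}
  fm fraction_map_is_zmod_morphism.
HB.instance Definition _ := GRing.isMonoidMorphism.Build {fraction R} {fraction R}
  fm fraction_map_is_monoid_morphism.

End FractionMap.

Section Popov.
Variable K : fieldType.

(* The pair (i, a) stands for the monomial e_i sigma^a.  The order is term over
   position, with e_0 the largest unit vector. *)
Definition mon_le m (mu nu : 'I_m * nat) : bool :=
  (mu.2 < nu.2)%N || (mu.2 == nu.2) && (nu.1 <= mu.1)%N.

Definition mon_dvd m (mu nu : 'I_m * nat) : bool :=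
  (mu.1 == nu.1) && (mu.2 <= nu.2)%N.

Definition mon_in m (v : 'rV[{poly K}]_m) (mu : 'I_m * nat) : bool :=
  (v 0 mu.1)`_mu.2 != 0.

Definition lead_mon m (v : 'rV[{poly K}]_m) (mu : 'I_m * nat) : Prop :=
  mon_in v mu /\ forall nu, mon_in v nu -> mon_le nu mu.

Definition rows_grobner r m (P : 'M[{poly K}]_(r, m)) : Prop :=
  forall c : 'rV[{poly K}]_r, c *m P != 0 ->
  exists i mu nu,
    [/\ lead_mon (row i P) mu, lead_mon (c *m P) nu & mon_dvd mu nu].

Definition rows_minimal r m (P : 'M[{poly K}]_(r, m)) : Prop :=
  (forall i, row i P != 0) /\
  (forall i j mu nu, i != j ->
     lead_mon (row i P) mu -> lead_mon (row j P) nu -> ~~ mon_dvd mu nu).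

Definition popov r m (P : 'M[{poly K}]_(r, m)) : Prop :=
  rows_grobner P /\ rows_minimal P.

(* some monomial of v, not necessarily the leading one, can be cancelled by P *)
Definition reducible r m (v : 'rV[{poly K}]_m) (P : 'M[{poly K}]_(r, m)) : Prop :=
  exists i mu nu, [/\ lead_mon (row i P) mu, mon_in v nu & mon_dvd mu nu].

End Popov.

Definition unimodular (R : nzRingType) m (U : 'M[R]_m) : Prop :=
  exists V : 'M[R]_m, U *m V = 1%:M /\ V *m U = 1%:M.

Section QSkew.
Variables (K : fieldType) (q : K).

Lemma comp_qX_inj : q != 0 -> injective (comp_poly (q *: 'X)).
Proof.
move=> q0; apply: (can_inj (g := comp_poly (q^-1 *: 'X))) => p.
by rewrite -comp_polyA comp_polyZ comp_polyX scalerA mulfV // scale1r comp_polyXr.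
Qed.

(* K[t, sigma]; in the coefficient ring {poly K} the variable 'X is t *)
Definition skewKt := skewpoly (comp_poly (q *: 'X)).
HB.instance Definition _ := GRing.NzRing.on skewKt.

(* K(t)[sigma] *)
Definition skewKft (q0 : q != 0) := skewpoly (fraction_map (comp_qX_inj q0)).
HB.instance Definition _ q0 := GRing.NzRing.on (skewKft q0).

Definition skewKt_to_Kft q0 (a : skewKt) : skewKft q0 :=
  map_poly (@FracField.tofrac {poly K}) (a : {poly {poly K}}).

(* K[sigma] is {poly K}, with 'X standing for sigma *)
Definition of_Ksigma (p : {poly K}) : skewKt := map_poly polyC p.

Definition skew_t : skewKt := ('X : {poly K})%:P.

(* the coefficient in K[sigma] of t^k, powers of t being written on the left *)
Definition tcoef (k : nat) (a : skewKt) : {poly K} :=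
  let p : {poly {poly K}} := a in \poly_(i < size p) p`_i`_k.

(* the t-degree, with value 0 at 0 *)
Definition tdeg1 (a : skewKt) : nat :=
  let p : {poly {poly K}} := a in \max_(i < size p) (size (p`_i)%R).-1.

Definition tdeg m (A : 'M[skewKt]_m) : nat :=
  \max_(i < m) \max_(j < m) tdeg1 (A i j).

Definition tlead m (A : 'M[skewKt]_m) : 'M[{poly K}]_m :=
  map_mx (tcoef (tdeg A)) A.

Definition regular (q0 : q != 0) m (A : 'M[skewKt]_m) : Prop :=
  forall v : 'rV[skewKft q0]_m, v *m map_mx (skewKt_to_Kft q0) A = 0 -> v = 0.

Definition equivalent (q0 : q != 0) m (A B : 'M[skewKt]_m) : Prop :=
  exists U : 'M[skewKft q0]_m, unimodular U /\
    map_mx (skewKt_to_Kft q0) B = U *m map_mx (skewKt_to_Kft q0) A.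

Lemma tcoefE k (a : skewKt) i : (tcoef k a)`_i = (a : {poly {poly K}})`_i`_k.
Proof.
rewrite coef_poly; case: ltnP => // le_ai.
by have -> : (a : {poly {poly K}})`_i = 0 by [exact: nth_default]; rewrite coef0.
Qed.

Lemma tcoefD k (a b : skewKt) : tcoef k (a + b) = tcoef k a + tcoef k b.
Proof. by apply/polyP => i; rewrite coefD !tcoefE coefD coefD. Qed.

Lemma tcoef0 k : tcoef k 0 = 0.
Proof. by apply/polyP => i; rewrite tcoefE !coef0. Qed.

Lemma tcoef_sum k (I : Type) (r : seq I) (F : I -> skewKt) :
  tcoef k (\sum_(i <- r) F i) = \sum_(i <- r) tcoef k (F i).
Proof. exact: (big_morph _ (tcoefD k) (tcoef0 k)). Qed.

Lemma tcoefZ k (c : K) (a : {poly {poly K}}) :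
  tcoef k (c%:P *: a) = c *: tcoef k a.
Proof. by apply/polyP => i; rewrite coefZ !tcoefE coefZ mul_polyC coefZ. Qed.

Lemma coef_comp_scaleX (c : K) (p : {poly K}) k :
  (p \Po (c *: 'X))`_k = c ^+ k * p`_k.
Proof.
rewrite comp_polyE coef_sum.
have [lt_kp|le_pk] := ltnP k (size p); last first.
  rewrite nth_default // mulr0 big1 // => i _; rewrite exprZn !coefZ coefXn.
  by rewrite gtn_eqF ?mulr0 // (leq_trans (ltn_ord i)).
rewrite (bigD1 (Ordinal lt_kp)) //= exprZn !coefZ coefXn eqxx mulr1 big1 => [|i].
  by rewrite addr0 mulrC.
by rewrite -val_eqE /= exprZn !coefZ coefXn eq_sym => /negPf ->; rewrite !mulr0.
Qed.

Lemma tcoef_sigma_mul k (a : {poly {poly K}}) :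
  tcoef k (sigma_mul (comp_poly (q *: 'X)) a) = (q ^+ k *: 'X) * tcoef k a.
Proof.
apply/polyP => i; rewrite tcoefE -scalerAl coefZ coefXM coefMX.
case: i => [|i]; first by rewrite !coef0 mulr0.
by rewrite /= tcoefE coef_map coef_comp_scaleX.
Qed.

Lemma tcoef_of_Ksigma k (p : {poly K}) (a : skewKt) :
  tcoef k (of_Ksigma p * a) = (p \Po (q ^+ k *: 'X)) * tcoef k a.
Proof.
rewrite skew_mulE (@skew_mul_widen _ _ (size p)) ?size_poly // tcoef_sum.
rewrite comp_polyE mulr_suml; apply: eq_bigr => i _.
rewrite coef_map /= tcoefZ -scalerAl; congr (_ *: _).
elim: (i : nat) => [|n IHn] /=; first by rewrite expr0 mul1r.
by rewrite tcoef_sigma_mul IHn exprS mulrA.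
Qed.

(* p(q^-l sigma) = t^l p(sigma) t^-l.  By tcoef_of_Ksigma, left multiplication
   by p itself acts on the coefficient of t^l as p(q^l sigma) and not as p;
   it is left multiplication by twist l p that acts as p. *)
Definition twist (l : nat) (p : {poly K}) : {poly K} := p \Po (q ^- l *: 'X).

(* t^l X t^-l A, where l is the t-degree of A *)
Definition act_tlead m (X : 'M[{poly K}]_m) (A : 'M[skewKt]_m) : 'M[skewKt]_m :=
  map_mx of_Ksigma (map_mx (twist (tdeg A)) X) *m A.

Lemma tcoef_act_tlead m (X : 'M[{poly K}]_m) (A : 'M[skewKt]_m) : q != 0 ->
  map_mx (tcoef (tdeg A)) (act_tlead X A) = X *m tlead A.
Proof.
move=> q0; apply/matrixP => i j; rewrite !mxE tcoef_sum; apply: eq_bigr => k _.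
rewrite !mxE tcoef_of_Ksigma /twist -comp_polyA comp_polyZ comp_polyX scalerA.
by rewrite mulVf ?expf_neq0 // scale1r comp_polyXr.
Qed.

Section Algorithm.
Variable m : nat.

Definition stack (R : Type) r s (E : (r + s)%N = m)
    (B : 'M[R]_(r, m)) (C : 'M[R]_(s, m)) : 'M[R]_m :=
  castmx (E, erefl m) (col_mx B C).

Definition square (R : Type) r s (E : (r + s)%N = m)
    (M11 : 'M[R]_r) (M12 : 'M[R]_(r, s)) (M21 : 'M[R]_(s, r)) (M22 : 'M[R]_s) :
    'M[R]_m :=
  castmx (E, E) (block_mx M11 M12 M21 M22).

Definition tshift r s (E : (r + s)%N = m) : 'M[skewKt]_m :=
  square E 1%:M 0 0 skew_t%:M.

(* Outer A: the determinant of tlead A is to be tested.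
   Inner E B A: the last s rows of A are to be multiplied by t; B is the Popov
   normal form that makes up the first r rows of tlead A. *)
Variant state : Type :=
  | Outer of 'M[skewKt]_m
  | Inner r s (E : (r + s)%N = m) of 'M[{poly K}]_(r, m) & 'M[skewKt]_m
  | Return of 'M[skewKt]_m.

(* One run of the algorithm is one sequence of steps: the transformation X to
   Popov normal form and the quotient X and remainder Y of the Groebner basis
   division are not unique, and every admissible choice gives a step. *)
Variant step : state -> state -> Prop :=
  | StepReturn A of \det (tlead A) != 0 : step (Outer A) (Return A)
  | StepPopov A r s (E : (r + s)%N = m) (X : 'M_m) (B : 'M_(r, m)) of
      \det (tlead A) = 0 &
      r = \rank (map_mx (@FracField.tofrac {poly K}) (tlead A)) &
      unimodular X & popov B & X *m tlead A = stack E B 0 :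
      step (Outer A) (Inner E B (act_tlead X A))
  | StepReduce A r s (E : (r + s)%N = m) (B : 'M_(r, m))
      (C : 'M_(s, m)) (X : 'M_(s, r)) (Y : 'M_(s, m)) of
      tlead (tshift E *m A) = stack E B C &
      C = X *m B + Y & (forall i, ~ reducible (row i Y) B) :
      let A' := act_tlead (square E 1%:M 0 (- X) 1%:M) (tshift E *m A) in
      step (Inner E B A) (if Y == 0 then Inner E B A' else Outer A').

Definition reachable : state -> state -> Prop := clos_refl_trans state step.

(* every sequence of steps starting in x is finite *)
Definition terminates (x : state) : Prop := Acc (fun y z => step z y) x.

End Algorithm.
End QSkew.

(* Main.v *)
Require Import Defs.
From mathcomp Require Import all_boot all_order all_algebra.
From mathcomp Require Import fingroup perm generic_quotient fraction.
From mathcomp Require Import zify.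
From HB Require Import structures.
From Stdlib Require Import Relation_Operators.

Set Implicit Arguments.
Unset Strict Implicit.
Unset Printing Implicit Defensive.

Import GRing.Theory.
Local Open Scope ring_scope.

(* Termination is a counting argument.  Fix a bound l on the t-degree; it is
   kept by all steps.  A step from the inner state A leads to Q T A, and the last
   row of A is K[sigma]-linearly independent modulo the row module of Q T A,
   since the last column of T consists of multiples of t.  After L such steps
   the last rows met on the way, together with the m rows of the current matrix,
   are L + m vectors that are independent over K[sigma], all in the free left
   K[sigma]-module of rank m(l+1) of vectors of t-degree at most l.  So L <= m l.

   For the Groebner bases, v in K[sigma]^m is encoded as the single polynomial
   sum_i v_i(X^m) X^(m-1-i): sigma becomes X^m, the monomials are numbered in the
   term over position order, and the position of a monomial is its exponent
   modulo m.  Hence a matrix with nonzero rows whose leading positions are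
   distinct is in Popov normal form, because the leading terms of the multiples
   of its rows cannot cancel. *)

(** * Ranks over the fraction field of an integral domain *)

Section FractionRank.
Variable R : idomainType.
Local Notation tofrac := (@FracField.tofrac R).

Lemma common_denominator n (v : 'rV[{fraction R}]_n) :
  exists2 d : R, d != 0 & exists w : 'rV_n, tofrac d *: v = map_mx tofrac w.
Proof.
exists (\prod_i \d_(repr (v 0 i))).
  by apply/prodf_neq0 => i _; exact: denom_ratioP.
exists (\row_i (\n_(repr (v 0 i)) * \prod_(j | j != i) \d_(repr (v 0 j)))).
apply/rowP => i; rewrite !mxE (bigD1 i) //= !rmorphM /= mulrAC; congr (_ * _).
by rewrite {2}[v 0 i]fraction_numden mulrC divfK // tofrac_eq0 denom_ratioP.
Qed.

(** Clearing denominators turns a kernel vector over the fraction field into one over [R], so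
    independence over [R] already gives full row rank. *)
Lemma rank_fraction_free a b (M : 'M[R]_(a, b)) :
  (forall c : 'rV_a, c *m M = 0 -> c = 0) -> \rank (map_mx tofrac M) = a.
Proof.
move=> free; apply/eqP; rewrite -/(row_free _) -kermx_eq0.
apply/eqP/row_matrixP => i; rewrite row0.
set v := row i _; have [d nz_d [w def_w]] := common_denominator v.
have w0 : w = 0.
  apply: free; apply/rowP => j; apply/eqP; rewrite -tofrac_eq; apply/eqP.
  transitivity (map_mx tofrac (w *m M) 0 j); first by rewrite [RHS]mxE.
  rewrite map_mxM -def_w -scalemxAl.
  by have /sub_kermxP -> := row_sub i (kermx (map_mx tofrac M));
    rewrite scaler0 !mxE tofrac0.
move: def_w; rewrite w0 map_mx0 => /eqP; rewrite scaler_eq0 tofrac_eq0.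
by rewrite (negPf nz_d) => /eqP.
Qed.

Lemma left_dependent a b (M : 'M[R]_(a, b)) :
  (forall c : 'rV_a, c *m M = 0 -> c = 0) -> (a <= b)%N.
Proof. by move=> /rank_fraction_free <-; exact: rank_leq_col. Qed.

Lemma rank_fraction_unimodular n b (X : 'M[R]_n) (M : 'M[R]_(n, b)) :
  unimodular X -> \rank (map_mx tofrac (X *m M)) = \rank (map_mx tofrac M).
Proof.
case=> V [_ VX]; rewrite map_mxM eqmxMfull //; apply/row_fullP.
by exists (map_mx tofrac V); rewrite -map_mxM VX map_mx1.
Qed.

Lemma rank_fraction_det0 n (M : 'M[R]_n) :
  \det M = 0 -> (\rank (map_mx tofrac M) < n)%N.
Proof.
move=> det0; rewrite ltn_neqAle rank_leq_row andbT -/(row_free _) row_free_unit.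
by rewrite unitmxE det_map_mx det0 rmorph0 unitr0.
Qed.

End FractionRank.

(** * Sorting permutations and sizes of sums *)

Lemma sort_perm n (a : pred 'I_n) : exists s : 'S_n, forall i, a (s i) = (i < #|a|)%N.
Proof.
pose t := [seq i <- enum 'I_n | a i] ++ [seq i <- enum 'I_n | ~~ a i].
have size_t : size t = n by rewrite size_cat !size_filter count_predC size_enum_ord.
have uniq_t : uniq t.
  have uniq_filter b : uniq [seq i <- enum 'I_n | b i] := filter_uniq b (enum_uniq _).
  rewrite cat_uniq !uniq_filter andbT /=; apply/hasPn => i.
  by rewrite !mem_filter => /andP[/negPf->].
have inj_t : injective (fun i : 'I_n => nth i t i).
  move=> i j /eqP; rewrite (set_nth_default i j) ?size_t //.
  by rewrite nth_uniq ?size_t // => /eqP/val_inj.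
exists (perm inj_t) => i; rewrite permE nth_cat.
have size_a : size [seq i <- enum 'I_n | a i] = #|a| by rewrite cardE enumT.
rewrite size_a; case: ltnP => [lt_i | le_i].
  have := @mem_nth _ i [seq i <- enum 'I_n | a i] i; rewrite size_a => /(_ lt_i).
  by rewrite mem_filter => /andP[].
have := @mem_nth _ i [seq i <- enum 'I_n | ~~ a i] (i - #|a|).
rewrite mem_filter; case: (a _) => //= in_t; suff: false by []; apply: in_t.
by rewrite -(ltn_add2r #|a|) subnK // addnC -size_a -size_cat -/t size_t.
Qed.

(** The top term of the largest nonzero summand meets no other term of its degree, so it survives in
    the sum. *)
Lemma size_sum_distinct (R : nzRingType) (I : finType) (F : I -> {poly R}) :
  (forall i j, F i != 0 -> F j != 0 -> size (F i) = size (F j) -> i = j) ->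
  forall i, F i != 0 ->
  exists2 j, F j != 0 & size (\sum_i F i) = size (F j).
Proof.
move=> distinct i nz_i; case: (@arg_maxnP _ i (fun j => F j != 0) (size \o F) nz_i)
  => j nz_j max_j.
exists j => //; rewrite (bigD1 j) //= size_polyDl //.
apply: leq_ltn_trans (size_sum _ _ _) _.
rewrite -(prednK (n := size (F j))) ?size_poly_gt0 // ltnS.
apply/bigmax_leqP => k ne_kj; have [-> | nz_k] := eqVneq (F k) 0.
  by rewrite size_poly0.
rewrite -ltnS prednK ?size_poly_gt0 // ltn_neqAle; apply/andP; split; last exact: max_j.
by apply: contra ne_kj => /eqP eq_kj; apply/eqP; exact: distinct.
Qed.

(** * Unimodular and block matrices *)

Lemma unimodular1 (R : nzRingType) n : unimodular (1%:M : 'M[R]_n).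
Proof. by exists 1%:M; rewrite mulmx1. Qed.

Lemma unimodularM (R : nzRingType) n (X Y : 'M[R]_n) :
  unimodular X -> unimodular Y -> unimodular (X *m Y).
Proof.
move=> [X' [XX' X'X]] [Y' [YY' Y'Y]]; exists (Y' *m X').
rewrite !mulmxA -(mulmxA X) YY' mulmx1 XX' -(mulmxA Y') X'X mulmx1 Y'Y.
by split.
Qed.

Lemma unimodular_map (R S : nzRingType) (f : {rmorphism R -> S}) n (X : 'M[R]_n) :
  unimodular X -> unimodular (map_mx f X).
Proof.
by case=> Y [XY YX]; exists (map_mx f Y); rewrite -!map_mxM XY YX map_mx1.
Qed.

(** Off the diagonal [delta_mx i j] has square zero, so replacing [a] by [- a] gives the inverse. *)
Lemma unimodular_transvection (R : nzRingType) n (i j : 'I_n) (a : R) : i != j ->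
  unimodular (1%:M + a *: delta_mx i j).
Proof.
move=> ne_ij; pose E : 'M[R]_n := a *: delta_mx i j.
have sqE : E *m E = 0.
  apply/matrixP => k l; rewrite !mxE big1 // => h _; rewrite !mxE.
  case: (h =P j) => [-> | _]; last by rewrite andbF mulr0 mul0r.
  by rewrite [j == i]eq_sym (negPf ne_ij) !mulr0.
exists (1%:M - E); split.
  by rewrite mulmxDl mul1mx mulmxBr mulmx1 sqE subr0 subrK.
by rewrite mulmxBl mul1mx mulmxDr mulmx1 sqE addr0 addrK.
Qed.

Lemma unimodular_perm (R : nzRingType) n (s : 'S_n) : unimodular (perm_mx s : 'M[R]_n).
Proof.
by exists (perm_mx s^-1); rewrite -!perm_mxM mulgV mulVg perm_mx1.
Qed.

Lemma unimodular_square (R : nzRingType) m r s (E : (r + s)%N = m) (X : 'M[R]_(s, r)) :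
  unimodular (square E 1%:M 0 X 1%:M).
Proof.
case: m / E; rewrite /square castmx_id; exists (block_mx 1%:M 0 (- X) 1%:M).
rewrite !mulmx_block !mulmx0 !mul0mx !mulmx1 !mul1mx !addr0 !add0r subrr addNr.
by rewrite -scalar_mx_block.
Qed.

Lemma unimodular_diag (R : nzRingType) m r s (E : (r + s)%N = m) (x y : R) :
  x * y = 1 -> y * x = 1 -> unimodular (square E 1%:M 0 0 x%:M).
Proof.
move=> xy yx; case: m / E; rewrite /square castmx_id; exists (block_mx 1%:M 0 0 y%:M).
rewrite !mulmx_block !mulmx0 !mul0mx !mulmx1 !addr0 !add0r -!scalar_mxM xy yx.
by rewrite -scalar_mx_block.
Qed.

Lemma stack_neq0 (R : nzRingType) m r s (E : (r + s)%N = m)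
    (B : 'M[R]_(r, m)) (C : 'M_(s, m)) :
  B != 0 -> stack E B C != 0.
Proof.
case: m / E B C => B C; rewrite /stack castmx_id; apply: contra_neq => BC0.
by rewrite -(col_mxKu B C) BC0 linear0.
Qed.

Lemma stack_reduce (R : nzRingType) m r s (E : (r + s)%N = m) (B : 'M[R]_(r, m)) C X :
  square E 1%:M 0 (- X) 1%:M *m stack E B C = stack E B (C - X *m B).
Proof.
case: m / E B C => B C; rewrite /square /stack !castmx_id mul_block_col.
by rewrite !mul1mx mul0mx addr0 mulNmx addrC.
Qed.

(** * Groebner bases over K[sigma] through the encoding by single polynomials *)

Section Flat.
Variables (K : fieldType) (m : nat).
Implicit Types (u v : 'rV[{poly K}]_m) (mu nu : 'I_m * nat).

(** The position is reversed because [e_0] is the largest unit vector. *)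
Definition code mu : nat := (mu.2 * m + rev_ord mu.1)%N.

Lemma code_mod mu : (code mu %% m = rev_ord mu.1)%N.
Proof. by rewrite /code modnMDl modn_small. Qed.

Lemma code_surj n : (0 < m)%N -> exists mu, code mu = n.
Proof.
move=> m_gt0; exists (rev_ord (Ordinal (ltn_pmod n m_gt0)), (n %/ m)%N).
by rewrite /code rev_ordK -divn_eq.
Qed.

Lemma mon_leE mu nu : mon_le mu nu = (code mu <= code nu)%N.
Proof.
case: mu nu => [i a] [j b]; rewrite /mon_le /code /=.
by have := ltn_ord i; have := ltn_ord j; nia.
Qed.

Lemma mon_dvdE mu nu :
  mon_dvd mu nu = (code mu == code nu %[mod m]) && (code mu <= code nu)%N.
Proof.
rewrite /mon_dvd !code_mod (inj_eq val_inj) (inj_eq rev_ord_inj).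
case: eqP => //= eq1; rewrite /code eq1 leq_add2r leq_pmul2r //.
exact: leq_trans (ltn0Sn _) (ltn_ord nu.1).
Qed.

Definition flat v : {poly K} :=
  \sum_(i < m) (v 0 i \Po 'X^m) * 'X^(rev_ord i).

Lemma coef_flat v mu : (flat v)`_(code mu) = (v 0 mu.1)`_mu.2.
Proof.
have m_gt0 : (0 < m)%N := leq_trans (ltn0Sn _) (ltn_ord mu.1).
rewrite coef_sum (bigD1 mu.1) //= big1 ?addr0 => [|i ne_i].
  rewrite coefMXn /code ltnNge leq_addl /= addnK coef_comp_poly_Xn //.
  by rewrite dvdn_mull // mulnK.
(* The summand of position [i] lives in exponents congruent to [rev_ord i] modulo [m], so the other
   positions contribute nothing. *)
rewrite coefMXn coef_comp_poly_Xn //; case: ltnP => // le_i.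
case: ifP => // /dvdnP[k def_k]; case/eqP: ne_i.
apply/rev_ord_inj/val_inj; rewrite -[RHS]code_mod -(subnK le_i) def_k modnMDl.
by rewrite modn_small //; exact: (ltn_ord (rev_ord i)).
Qed.

Lemma flatD u v : flat (u + v) = flat u + flat v.
Proof.
rewrite -big_split; apply: eq_bigr => i _.
by rewrite mxE comp_polyD mulrDl.
Qed.

Lemma flat0 : flat 0 = 0.
Proof. by rewrite /flat big1 // => i _; rewrite mxE comp_poly0 mul0r. Qed.

Lemma flatZ p v : flat (p *: v) = (p \Po 'X^m) * flat v.
Proof.
rewrite mulr_sumr; apply: eq_bigr => i _.
by rewrite mxE comp_polyM mulrA.
Qed.

Lemma flatB u v : flat (u - v) = flat u - flat v.
Proof. by rewrite flatD -scaleN1r flatZ -polyCN comp_polyC mul_polyC scaleN1r. Qed.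

Lemma flat_sum (I : Type) (r : seq I) (F : I -> 'rV[{poly K}]_m) :
  flat (\sum_(i <- r) F i) = \sum_(i <- r) flat (F i).
Proof. exact: (big_morph _ flatD flat0). Qed.

Lemma flat_eq0 v : (flat v == 0) = (v == 0).
Proof.
apply/eqP/eqP => [flat_v | ->]; last exact: flat0.
apply/rowP => i; rewrite mxE; apply/polyP => a.
by rewrite -(coef_flat v (i, a)) flat_v !coef0.
Qed.

Lemma size_flat_pos v : v != 0 -> (0 < m)%N /\ exists mu, size (flat v) = (code mu).+1.
Proof.
move=> nz_v; have m_gt0 : (0 < m)%N.
  by have [i _] := rV0Pn _ nz_v; apply: leq_ltn_trans (ltn_ord i).
split=> //; have [mu def_mu] := code_surj (size (flat v)).-1 m_gt0.
by exists mu; rewrite def_mu prednK // size_poly_gt0 flat_eq0.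
Qed.

Lemma mon_inE v mu : mon_in v mu = ((flat v)`_(code mu) != 0).
Proof. by rewrite coef_flat. Qed.

Lemma lead_monE v mu : lead_mon v mu <-> size (flat v) = (code mu).+1.
Proof.
split=> [[v_mu le_mu] | size_v].
  have nz_v : v != 0 by apply: contraNneq v_mu => ->; rewrite mxE coef0.
  have [_ [nu size_v]] := size_flat_pos nz_v.
  apply/eqP; rewrite eqn_leq size_v ltnS -mon_leE le_mu /=; last first.
    by rewrite mon_inE -[code nu]/((code nu).+1.-1) -size_v -/(lead_coef _)
      lead_coef_eq0 flat_eq0.
  rewrite -size_v ltnNge; apply: contra v_mu => le_v.
  by rewrite -coef_flat nth_default.
split=> [|nu]; rewrite mon_inE.
  rewrite -[code mu]/((code mu).+1.-1) -size_v -/(lead_coef _) lead_coef_eq0.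
  by rewrite -size_poly_eq0 size_v.
by rewrite mon_leE -ltnS -size_v ltnNge; apply: contra => le_v; rewrite nth_default.
Qed.

(** Multiplication by [p] raises the leading exponent by a multiple of [m]; hence it preserves the
    leading position. *)
Lemma size_flatZ p v : p != 0 -> v != 0 ->
  size (flat (p *: v)) = ((size p).-1 * m + size (flat v))%N.
Proof.
move=> nz_p nz_v; have [m_gt0 _] := size_flat_pos nz_v.
have nz_pX : p \Po 'X^m != 0 by rewrite comp_poly_eq0 // size_polyXn ltnS.
rewrite flatZ size_mul ?flat_eq0 // -(prednK (n := size (p \Po _))).
  by rewrite size_comp_poly size_polyXn addSn.
by rewrite size_poly_gt0.
Qed.

(* counted from the last position; meaningless at v = 0 *)
Definition lead_pos v : nat := ((size (flat v)).-1 %% m)%N.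

(** The weak Popov condition. Zero rows are exempt, so that it also makes sense for matrices of
    deficient rank. *)
Definition distinct_leads r (P : 'M[{poly K}]_(r, m)) : Prop :=
  forall i j, row i P != 0 -> row j P != 0 ->
    lead_pos (row i P) = lead_pos (row j P) -> i = j.

Lemma lead_posE v mu : size (flat v) = (code mu).+1 -> lead_pos v = (code mu %% m)%N.
Proof. by rewrite /lead_pos => ->. Qed.

Section DistinctLeads.
Variables (r : nat) (P : 'M[{poly K}]_(r, m)).
Hypotheses (nzP : forall i, row i P != 0) (distP : distinct_leads P).

(** The nonzero terms [c 0 i *: row i P] have leading exponents in distinct classes modulo [m], so
    their sizes differ and the largest one survives. *)
Lemma size_flat_mulmx (c : 'rV_r) : c != 0 ->
  exists2 i, c 0 i != 0 & size (flat (c *m P)) = size (flat (c 0 i *: row i P)).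
Proof.
move=> /rV0Pn[i nz_i]; rewrite mulmx_sum_row flat_sum.
have flat_i j : (flat (c 0 j *: row j P) != 0) = (c 0 j != 0).
  by rewrite flat_eq0 scalemx_eq0 (negPf (nzP j)) orbF.
have dist j k : flat (c 0 j *: row j P) != 0 -> flat (c 0 k *: row k P) != 0 ->
    size (flat (c 0 j *: row j P)) = size (flat (c 0 k *: row k P)) -> j = k.
  rewrite !flat_i => nz_j nz_k; rewrite !size_flatZ // => eq_jk.
  apply: distP => //; rewrite /lead_pos -(modnMDl (size (c 0 j)).-1).
  rewrite -(modnMDl (size (c 0 k)).-1 (size (flat (row k P))).-1).
  have sz l : size (flat (row l P)) = (size (flat (row l P))).-1.+1.
    by rewrite prednK // size_poly_gt0 flat_eq0.
  by move: eq_jk; rewrite (sz j) (sz k) !addnS => -[->].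
have [|j] := size_sum_distinct dist (i := i); first by rewrite flat_i.
by rewrite flat_i; exists j.
Qed.

Lemma distinct_leads_free (c : 'rV_r) : c *m P = 0 -> c = 0.
Proof.
move=> cP0; apply/eqP; apply/negPn/negP => /size_flat_mulmx[i nz_i].
rewrite cP0 flat0 size_poly0 => /esym/eqP.
by rewrite size_poly_eq0 flat_eq0 scalemx_eq0 (negPf nz_i) (negPf (nzP i)).
Qed.

(** A combination has the leading monomial of a multiple of one row, which the leading monomial of
    that row divides. Minimality holds since monomials in different positions do not divide each
    other. *)
Lemma distinct_leads_popov : popov P.
Proof.
split=> [c nz_cP | ]; last split=> // i j mu nu ne_ij.
  have nz_c : c != 0 by apply: contraNneq nz_cP => ->; rewrite mul0mx.
  have [i nz_i size_cP] := size_flat_mulmx nz_c.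
  have [_ [mu size_mu]] := size_flat_pos (nzP i).
  have [_ [nu size_nu]] := size_flat_pos nz_cP.
  exists i, mu, nu; split; [exact/lead_monE | exact/lead_monE |].
  move: size_cP; rewrite size_nu size_flatZ // size_mu addnS => -[code_nu].
  by rewrite mon_dvdE code_nu modnMDl eqxx leq_addl.
move=> /lead_monE/lead_posE lead_i /lead_monE/lead_posE lead_j.
rewrite mon_dvdE -lead_i -lead_j; apply: contra ne_ij => /andP[/eqP eq_ij _].
by apply/eqP; apply: distP.
Qed.

End DistinctLeads.

Lemma flat_multiple u n (a : K) : u != 0 ->
  lead_pos u = (n %% m)%N -> ((size (flat u)).-1 <= n)%N ->
  exists p, (size (flat (p *: u)) <= n.+1)%N /\ (flat (p *: u))`_n = a.
Proof.
move=> nz_u eq_pos le_un; have [m_gt0 _] := size_flat_pos nz_u.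
(* The gap between the exponents is divisible by [m], so the multiple by [b sigma^k] moves the
   leading term of [u] exactly to exponent [n], with coefficient [a]. *)
pose k := ((n - (size (flat u)).-1) %/ m)%N; pose b := a / lead_coef (flat u).
have nz_lu : lead_coef (flat u) != 0 by rewrite lead_coef_eq0 flat_eq0.
have su : (0 < size (flat u))%N by rewrite size_poly_gt0 flat_eq0.
have def_n : n = (m * k + (size (flat u)).-1)%N.
  by rewrite mulnC divnK ?subnK // -eqn_mod_dvd //; exact/eqP/esym.
exists (b *: 'X^k).
rewrite flatZ comp_polyZ comp_Xn_poly -exprM -scalerAl coefZ.
split; last by rewrite def_n coefXnM ltnNge leq_addr /= addKn divfK.
apply: leq_trans (size_scale_leq _ _) _; apply: leq_trans (size_polyMleq _ _) _.
by rewrite size_polyXn def_n addSn /= -addnS prednK.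
Qed.

Lemma lead_cancel u v : u != 0 -> v != 0 -> lead_pos u = lead_pos v ->
  (size (flat u) <= size (flat v))%N ->
  exists p, (size (flat (v - p *: u)%R) < size (flat v))%N.
Proof.
move=> nz_u nz_v eq_pos le_uv.
have sv : (0 < size (flat v))%N by rewrite size_poly_gt0 flat_eq0.
have le_uv1 : ((size (flat u)).-1 <= (size (flat v)).-1)%N.
  by rewrite -!subn1 leq_sub2r.
have [p [size_p lead_p]] := flat_multiple (lead_coef (flat v)) nz_u eq_pos le_uv1.
exists p; rewrite -[X in (_ < X)%N](prednK sv) ltnS flatB; apply/leq_sizeP => j.
rewrite leq_eqVlt => /predU1P[<- | lt_j]; first by rewrite coefB lead_p subrr.
by rewrite coefB !nth_default ?subrr // ?(leq_trans size_p) // -(prednK sv).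
Qed.

(** * Division with remainder *)

Section Division.
Variables (r : nat) (P : 'M[{poly K}]_(r, m)).

(** Divisibility of the monomial with code [n] by the leading monomial of some row. Zero rows are
    excluded because [lead_pos] would give them a spurious one. *)
Let divides n := [exists i, [&& row i P != 0,
  lead_pos (row i P) == (n %% m)%N & ((size (flat (row i P))).-1 <= n)%N]].

Lemma reducibleP v : reducible v P -> exists2 n, divides n & (flat v)`_n != 0.
Proof.
move=> [i [mu [nu [/lead_monE lead_i v_nu]]]].
rewrite mon_dvdE => /andP[/eqP eq_mod le_code].
exists (code nu); last by rewrite -mon_inE.
apply/existsP; exists i; rewrite lead_i le_code (lead_posE lead_i) eq_mod eqxx.
by rewrite !andbT -flat_eq0 -size_poly_eq0 lead_i.
Qed.

Lemma row_division v : exists x : 'rV_r, ~ reducible (v - x *m P) P.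
Proof.
(* Reduction runs from the top down: [N] bounds the exponents still reducible, and cancelling at an
   exponent leaves all higher ones unchanged. *)
suff div N w : (forall n, divides n -> (flat w)`_n != 0 -> (n < N)%N) ->
    exists x : 'rV_r, ~ reducible (w - x *m P) P.
  apply: (div (size (flat v)) v) => n _; rewrite ltnNge.
  by apply: contra => le_n; rewrite nth_default.
elim: N w => [|N IHN] w small.
  exists 0; rewrite mul0mx subr0 => /reducibleP[n div_n nz_n].
  by have := small n div_n nz_n.
case: (boolP (divides N)) => [|ndiv_N]; last first.
  apply: IHN => n div_n nz_n; have := small n div_n nz_n.
  by rewrite ltnS leq_eqVlt => /predU1P[def_n | //]; rewrite -def_n div_n in ndiv_N.
move=> /existsP[i /and3P[nz_i /eqP pos_i le_i]].
have [p [size_p coef_p]] := flat_multiple (flat w)`_N nz_i pos_i le_i.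
have [n div_n | x irr_x] := IHN (w - p *: row i P).
  rewrite flatB coefB => nz_n.
  case: (ltngtP n N) => // [lt_Nn | def_n]; last first.
    by rewrite def_n coef_p subrr eqxx in nz_n.
  move: nz_n; rewrite [(flat (p *: _))`_n]nth_default ?(leq_trans size_p) //.
  by rewrite subr0 => /(small n div_n); rewrite ltnS leqNgt lt_Nn.
exists (x + p *: delta_mx 0 i); move: irr_x.
by rewrite mulmxDl -scalemxAl -rowE opprD addrCA addrC.
Qed.

Lemma division s (C : 'M[{poly K}]_(s, m)) : exists (X : 'M_(s, r)) (Y : 'M_(s, m)),
  C = X *m P + Y /\ forall i, ~ reducible (row i Y) P.
Proof.
have [x irr_x] := fin_all_exists (fun i => row_division (row i C)).
exists (\matrix_i x i), (C - (\matrix_i x i) *m P); split; first by rewrite addrC subrK.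
by move=> i; rewrite linearB /= row_mul rowK.
Qed.

End Division.

(** * Existence of the Popov form *)

(** While two nonzero rows share their leading position, a multiple of the smaller is subtracted
    from the larger; each time the sum of the sizes drops. *)
Lemma weak_popov n (M : 'M[{poly K}]_(n, m)) :
  exists2 X : 'M_n, unimodular X & distinct_leads (X *m M).
Proof.
have [N] := ubnP (\sum_i size (flat (row i M)))%N; elim: N M => // N IHN M.
rewrite ltnS => le_N.
case: (boolP [exists i, exists j, [&& row i M != 0, row j M != 0,
    lead_pos (row i M) == lead_pos (row j M), i != j &
    (size (flat (row i M)) <= size (flat (row j M)))%N]]).
  move=> /existsP[i /existsP[j /and5P[nz_i nz_j /eqP eq_ij ne_ij le_ij]]].
  have [p lt_p] := lead_cancel nz_i nz_j eq_ij le_ij.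
  pose X : 'M_n := 1%:M + (- p) *: delta_mx j i.
  have rowX k : row k (X *m M) = if k == j then row j M - p *: row i M else row k M.
    have -> : X *m M = M - p *: (delta_mx j i *m M).
      by rewrite mulmxDl mul1mx -scalemxAl scaleNr.
    rewrite linearB linearZ /= row_mul.
    have -> : row k (delta_mx j i : 'M[{poly K}]_n) = (k == j)%:R *: delta_mx 0 i.
      by apply/rowP => l; rewrite !mxE eqxx -natrM mulnb.
    rewrite -scalemxAl -rowE; case: eqP => [-> | _]; first by rewrite scale1r.
    by rewrite scale0r scaler0 subr0.
  have [|Y uY distY] := IHN (X *m M).
    apply: leq_trans le_N; rewrite (bigD1 j) //= [ltnRHS](bigD1 j) //= rowX eqxx.
    rewrite -addSn; apply: leq_add => //; apply: leq_sum => k /negPf ne_k.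
    by rewrite rowX ne_k.
  exists (Y *m X); last by rewrite -mulmxA.
  by apply: unimodularM => //; apply: unimodular_transvection; rewrite eq_sym.
move=> no_pair; exists 1%:M; first exact: unimodular1.
rewrite mul1mx => i j nz_i nz_j eq_ij; apply/eqP; apply: contraNT no_pair => ne_ij.
case: (leqP (size (flat (row i M))) (size (flat (row j M)))) => [le_ij | /ltnW le_ji].
  by apply/existsP; exists i; apply/existsP; exists j; rewrite nz_i nz_j eq_ij eqxx ne_ij.
apply/existsP; exists j; apply/existsP; exists i.
by rewrite nz_i nz_j eq_ij eqxx eq_sym ne_ij.
Qed.

(** Moving the zero rows of a weak Popov form to the bottom leaves an upper block with distinct
    leads. Its rows are independent, so their number is the rank of [M]. *)
Lemma popov_form n (M : 'M[{poly K}]_(n, m)) :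
  exists r s (E : (r + s)%N = n) (X : 'M_n) (B : 'M_(r, m)),
  [/\ r = \rank (map_mx (@FracField.tofrac {poly K}) M), unimodular X,
      popov B & X *m M = castmx (E, erefl m) (col_mx B 0)].
Proof.
have [Y uY distY] := weak_popov M; pose N := Y *m M.
have [p pP] := sort_perm (fun i => row i N != 0).
set r := #|_| in pP; have le_rn : (r <= n)%N by rewrite -[n in leqRHS]card_ord max_card.
have E : (r + (n - r))%N = n by rewrite subnKC.
pose X := perm_mx p *m Y; pose D := castmx (esym E, erefl m) (X *m M).
have rowD k : row k D = row (p (cast_ord E k)) N.
  apply/rowP => j; rewrite !mxE castmxE /= -mulmxA -row_permE mxE !cast_ord_id.
  by rewrite esymK mxE.
have D0 : dsubmx D = 0.
  apply/row_matrixP => i; rewrite row0 row_dsubmx rowD; apply/eqP.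
  by rewrite -[_ == 0]negbK pP -leqNgt leq_addr.
pose B := usubmx D; have rowB i : row i B = row (p (cast_ord E (lshift _ i))) N.
  by rewrite row_usubmx rowD.
have nzB i : row i B != 0 by rewrite rowB pP /=.
have distB : distinct_leads B.
  move=> i j nz_i nz_j; rewrite !rowB => eq_ij; apply: (@lshift_inj _ (n - r)).
  apply/(@cast_ord_inj _ _ E)/(@perm_inj _ p).
  by apply: distY => //; rewrite -/N -rowB.
have XM : X *m M = castmx (E, erefl m) (col_mx B 0).
  by rewrite -D0 vsubmxK castmxKV.
have uX : unimodular X by apply: unimodularM => //; exact: unimodular_perm.
exists r, (n - r)%N, E, X, B; split=> //; last exact: distinct_leads_popov.
rewrite -(rank_fraction_unimodular M uX) XM.
have free_B : \rank (map_mx (@FracField.tofrac {poly K}) B) = r.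
  by apply: rank_fraction_free => c; apply: distinct_leads_free.
(* Generalised over the heights, so that the cast can be removed by cases on the equality. *)
suff rank_cast h (E' : h = n) (C : 'M[{poly K}]_(h, m)) :
    \rank (map_mx (@FracField.tofrac {poly K}) (castmx (E', erefl m) C)) =
    \rank (map_mx (@FracField.tofrac {poly K}) C).
  by rewrite rank_cast map_col_mx map_mx0 rank_col_mx0.
by case: n / E' {M Y uY distY N p r pP le_rn E X D rowD D0 B rowB nzB distB XM uX free_B}.
Qed.

End Flat.

(** * Skew polynomials by their coefficients at powers of t *)

Section Skew.
Variables (K : fieldType) (q : K).
Local Notation skew := (skewKt q).
Local Notation ofK := (@of_Ksigma K q).

Lemma tcoef_inj (a b : skew) : (forall k, tcoef k a = tcoef k b) -> a = b.
Proof.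
move=> eq_ab; apply/polyP => i; apply/polyP => k.
by rewrite -!(@tcoefE K q) eq_ab.
Qed.

Lemma tcoef_const k (p : {poly K}) : tcoef k (ofK p) = if k == 0%N then p else 0.
Proof.
apply/polyP => i; rewrite tcoefE coef_map /= coefC.
by case: eqP => // _; rewrite coef0.
Qed.

Fact of_Ksigma_is_zmod_morphism : zmod_morphism ofK.
Proof. by move=> a b; exact: (raddfB (map_poly (@polyC K))). Qed.

Fact of_Ksigma_is_monoid_morphism : monoid_morphism ofK.
Proof.
split=> [|a b]; first exact: (rmorph1 (map_poly (@polyC K))).
(* Only [k = 0] matters, and there the scaling of sigma by [q ^+ 0] is trivial. *)
apply: tcoef_inj => k; rewrite tcoef_of_Ksigma !tcoef_const.
by case: eqP => [-> | _]; rewrite ?mulr0 // expr0 scale1r comp_polyXr.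
Qed.

HB.instance Definition _ := GRing.isZmodMorphism.Build {poly K} skew
  (@of_Ksigma K q) of_Ksigma_is_zmod_morphism.
HB.instance Definition _ := GRing.isMonoidMorphism.Build {poly K} skew
  (@of_Ksigma K q) of_Ksigma_is_monoid_morphism.

HB.instance Definition _ l :=
  GRing.RMorphism.copy (@twist K q l) (comp_poly (q ^- l *: 'X)).

(** Moving t to the left across powers of sigma costs only powers of [q], so t remains a factor. *)
Lemma tcoefM_t a : tcoef 0 (a * skew_t q) = 0.
Proof.
rewrite skew_mulE tcoef_sum big1 // => i _.
have t0 : tcoef 0 (iter i (sigma_mul (comp_poly (q *: 'X))) (skew_t q) : skew) = 0.
  elim: (i : nat) => [|n IHn] /=; last by rewrite tcoef_sigma_mul IHn mulr0.
  apply/polyP => j; rewrite tcoefE coefC coef0.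
  by case: eqP; rewrite ?coefX ?coef0.
apply/polyP => j; have := congr1 (fun p : {poly K} => p`_j) t0.
rewrite !tcoefE coefZ => t0j.
by rewrite coefM big_ord1 t0j coef0 mulr0.
Qed.

Lemma tcoef_tM k a : tcoef k (skew_t q * a) = if k is k'.+1 then tcoef k' a else 0.
Proof.
apply/polyP => i; rewrite tcoefE skew_mulE (@skew_mul_widen _ _ 1) ?size_polyC_leq1 //.
rewrite big_ord1 coefC /= coefZ coefXM; case: k => [|k] /=; first by rewrite coef0.
by rewrite tcoefE.
Qed.

(** Rectangular matrices are allowed, since the counting argument bounds the degrees of collections
    of rows. *)
Definition tdeg_le m n (l : nat) (A : 'M[skew]_(m, n)) : Prop :=
  forall i j k, (l < k)%N -> tcoef k (A i j) = 0.

Lemma tdeg1_leq (a : skew) l : (forall k, (l < k)%N -> tcoef k a = 0) -> (tdeg1 a <= l)%N.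
Proof.
move=> a0; apply/bigmax_leqP => i _; rewrite leqNgt; apply/negP => lt_l.
have /(congr1 (fun p : {poly K} => p`_i)) := a0 _ lt_l.
rewrite tcoefE coef0 -/(lead_coef _) => /eqP; rewrite lead_coef_eq0 => /eqP ai0.
by rewrite ai0 size_poly0 in lt_l.
Qed.

Lemma tcoef_gt_tdeg1 (a : skew) k : (tdeg1 a < k)%N -> tcoef k a = 0.
Proof.
move=> lt_k; apply/polyP => i; rewrite tcoefE coef0.
case: (ltnP i (size (a : {poly {poly K}}))) => [lt_i | le_i]; last first.
  by have -> : (a : {poly {poly K}})`_i = 0 by [exact: nth_default]; rewrite coef0.
apply: nth_default; rewrite -ltnS (leq_ltn_trans (leqSpred _)) // ltnS.
apply: leq_ltn_trans lt_k.
exact: (@leq_bigmax _ (fun i : 'I__ => (size ((a : {poly {poly K}})`_i)%R).-1)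
  (Ordinal lt_i)).
Qed.

Section Matrices.
Variable m : nat.
Implicit Types A : 'M[skew]_m.

Lemma tdeg_leP A l : tdeg_le l A <-> (tdeg A <= l)%N.
Proof.
split=> [degA | le_l i j k lt_k].
  apply/bigmax_leqP => i _; apply/bigmax_leqP => j _.
  by apply: tdeg1_leq => k; exact: degA.
apply: tcoef_gt_tdeg1; apply: leq_ltn_trans lt_k; apply: leq_trans le_l.
apply: leq_trans (leq_bigmax (F := fun i => \max_(j < m) tdeg1 (A i j)) i).
exact: (leq_bigmax (F := fun j => tdeg1 (A i j)) j).
Qed.

(** A vanishing coefficient at the t-degree would lower that degree, unless it is 0; then the matrix
    itself vanishes. *)
Lemma tlead_eq0 A : tlead A = 0 -> A = 0.
Proof.
move=> lead0; have deg := (tdeg_leP A _).2 (leqnn _).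
have coef_lead i j : tcoef (tdeg A) (A i j) = 0.
  by have /matrixP/(_ i j) := lead0; rewrite !mxE.
case def_l: (tdeg A) deg coef_lead => [|l] deg coef_lead.
  apply/matrixP => i j; rewrite mxE; apply: tcoef_inj => k.
  by rewrite tcoef0; case: k => [|k]; [exact: coef_lead | exact: deg].
suff : (tdeg A <= l)%N by rewrite def_l ltnn.
apply/tdeg_leP => i j k; rewrite leq_eqVlt => /predU1P[<- // | lt_k]; exact: deg.
Qed.

Lemma tlead_tcoef A l : tdeg_le l A -> map_mx (tcoef l) A != 0 ->
  tdeg A = l /\ tlead A = map_mx (tcoef l) A.
Proof.
move=> degA nzA; have def_l : tdeg A = l.
  apply/eqP; rewrite eqn_leq; have /tdeg_leP -> := degA; rewrite leqNgt.
  apply: contra nzA => lt_l; apply/eqP/matrixP => i j; rewrite !mxE.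
  exact: ((tdeg_leP A _).2 (leqnn _)).
by rewrite /tlead def_l.
Qed.

Lemma tdeg_le_mulK n p l (X : 'M[{poly K}]_(n, p)) (A : 'M[skew]_(p, m)) :
  tdeg_le l A -> tdeg_le l (map_mx ofK X *m A).
Proof.
move=> degA i j k lt_k; rewrite mxE tcoef_sum big1 // => h _.
by rewrite mxE tcoef_of_Ksigma degA ?mulr0.
Qed.

End Matrices.

(** * Embedding into K(t)[sigma], regularity and equivalence *)

Section Fractions.
Variable q0 : q != 0.
Local Notation skewF := (skewKft q0).
Local Notation toF := (skewKt_to_Kft q0).

Lemma toF_sigma_mul (a : {poly {poly K}}) :
  map_poly (@FracField.tofrac {poly K}) (sigma_mul (comp_poly (q *: 'X)) a)
    = sigma_mul (fraction_map (comp_qX_inj q0)) (map_poly (@FracField.tofrac {poly K}) a).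
Proof.
rewrite /sigma_mul rmorphM /= map_polyX; congr (_ * _).
by apply/polyP => i; rewrite !coef_map /= fraction_map_tofrac.
Qed.

Fact toF_is_zmod_morphism : zmod_morphism toF.
Proof. by move=> a b; exact: (raddfB (map_poly (@FracField.tofrac {poly K}))). Qed.

Fact toF_is_monoid_morphism : monoid_morphism toF.
Proof.
split=> [|a b]; first exact: (rmorph1 (map_poly (@FracField.tofrac {poly K}))).
rewrite !skew_mulE [RHS](@skew_mul_widen _ _ (size (a : {poly {poly K}}))) ?size_poly //.
rewrite /skewKt_to_Kft /skew_mul rmorph_sum; apply: eq_bigr => i _.
rewrite /= map_polyZ coef_map; congr (_ *: _).
by elim: (i : nat) => //= n <-; rewrite toF_sigma_mul.
Qed.

HB.instance Definition _ := GRing.isZmodMorphism.Build skew skewF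
  (@skewKt_to_Kft K q q0) toF_is_zmod_morphism.
HB.instance Definition _ := GRing.isMonoidMorphism.Build skew skewF
  (@skewKt_to_Kft K q q0) toF_is_monoid_morphism.

Lemma toF_inj : injective toF.
Proof.
move=> a b /polyP eq_ab; apply/polyP => i; apply/eqP.
by have /eqP := eq_ab i; rewrite !coef_map tofrac_eq.
Qed.

Lemma regular_free m (A : 'M[skew]_m) (v : 'rV_m) :
  regular q0 A -> v *m A = 0 -> v = 0.
Proof.
move=> regA vA0; apply/rowP => j; apply: toF_inj; rewrite mxE raddf0.
have /rowP/(_ j) : map_mx toF v = 0 by apply: regA; rewrite -map_mxM vA0 map_mx0.
by rewrite !mxE.
Qed.

Lemma regular_equivalent m (A B : 'M[skew]_m) :
  equivalent q0 A B -> regular q0 A -> regular q0 B.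
Proof.
move=> [U [[V [UV VU]] eq_B]] regA v; rewrite eq_B mulmxA => /regA vU0.
by rewrite -[v]mulmx1 -UV mulmxA vU0 mul0mx.
Qed.

Lemma equivalent_refl m (A : 'M[skew]_m) : equivalent q0 A A.
Proof. by exists 1%:M; rewrite mul1mx; split; first exact: unimodular1. Qed.

Lemma equivalent_mul m (A B : 'M[skew]_m) (G : 'M_m) :
  unimodular (map_mx toF G) -> equivalent q0 A B -> equivalent q0 A (G *m B).
Proof.
move=> uG [U [uU eq_B]]; exists (map_mx toF G *m U); split; first exact: unimodularM.
by rewrite map_mxM eq_B mulmxA.
Qed.

Lemma unimodular_act m l (X : 'M[{poly K}]_m) : unimodular X ->
  unimodular (map_mx ofK (map_mx (twist q l) X)).
Proof. by move=> uX; apply/unimodular_map/unimodular_map. Qed.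

(** The shift becomes invertible only here, because t is a unit in K(t). *)
Lemma unimodular_tshift m r s (E : (r + s)%N = m) : unimodular (map_mx toF (tshift q E)).
Proof.
pose t : {fraction {poly K}} := tofrac 'X.
have nz_t : t != 0 by rewrite tofrac_eq0 polyX_eq0.
pose c (x : {fraction {poly K}}) : skewF := x%:P.
have cM x y : c x * c y = c (x * y).
  rewrite skew_mulE (@skew_mul_widen _ _ 1) ?size_polyC_leq1 // big_ord1 coefC.
  by rewrite /= -mul_polyC -polyCM.
have toF_t : toF (skew_t q) = c t by rewrite /skewKt_to_Kft map_polyC.
have -> : map_mx toF (tshift q E) = square E 1%:M 0 0 (c t)%:M.
  case: m / E; rewrite /tshift /square !castmx_id map_block_mx !map_mx0 map_mx1.
  by rewrite map_scalar_mx /= toF_t.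
have c1 : c 1 = 1 by exact: polyC1.
have ctV : c t * c t^-1 = 1 by rewrite cM mulfV.
have cVt : c t^-1 * c t = 1 by rewrite cM mulVf.
exact: (@unimodular_diag skewF _ _ _ E _ _ ctV cVt).
Qed.

End Fractions.
End Skew.

(** * Counting vectors independent over K[sigma] *)

Section Termination.
Variables (K : fieldType) (q : K) (q0 : q != 0) (m : nat).
Local Notation skew := (skewKt q).
Local Notation ofK := (@of_Ksigma K q).

Lemma twistK k (p : {poly K}) : twist q k (p \Po (q ^+ k *: 'X)) = p.
Proof.
by rewrite /twist -comp_polyA comp_polyZ comp_polyX scalerA mulfV ?expf_neq0 //
  scale1r comp_polyXr.
Qed.

Lemma twist_inj k : injective (twist q k).
Proof.
apply: (can_inj (g := comp_poly (q ^+ k *: 'X))) => p.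
by rewrite /twist -comp_polyA comp_polyZ comp_polyX scalerA mulVf ?expf_neq0 //
  scale1r comp_polyXr.
Qed.

(* The coefficients of t^0, ..., t^l with the powers of t on the right are
   K[sigma]-linear coordinates on the vectors of t-degree at most l, which
   therefore form a free left module of rank m(l+1). *)
Lemma free_rows_leq n l (W : 'M[skew]_(n, m)) : tdeg_le l W ->
  (forall c : 'rV_n, map_mx ofK c *m W = 0 -> c = 0) -> (n <= m * l.+1)%N.
Proof.
move=> degW freeW.
pose coords := \matrix_i mxvec (\matrix_(j < m, k < l.+1) twist q k (tcoef k (W i j))).
apply: (@left_dependent _ _ _ coords) => c c0; apply: freeW.
have degcW := tdeg_le_mulK c degW.
apply/matrixP => i j; rewrite ord1 [RHS]mxE; apply: tcoef_inj => k; rewrite tcoef0.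
case: (leqP k l) => [le_k | /degcW //]; apply: (@twist_inj k); rewrite rmorph0.
have /rowP/(_ (mxvec_index j (Ordinal (le_k : (k < l.+1)%N)))) := c0.
rewrite !mxE => <-; rewrite tcoef_sum rmorph_sum; apply: eq_bigr => h _.
by rewrite !mxE mxvecE mxE tcoef_of_Ksigma rmorphM /= twistK.
Qed.

(** The scalars [c] lie in K[sigma], while [v] ranges over K[t, sigma]: the rows of [U] are
    K[sigma]-independent in the quotient by the row module of [A]. *)
Definition independent_modulo l L (A : 'M[skew]_m) : Prop :=
  exists2 U : 'M[skew]_(L, m), tdeg_le l U &
  forall (c : 'rV_L) (v : 'rV_m), map_mx ofK c *m U + v *m A = 0 -> c = 0.

Lemma independent_modulo0 l A : independent_modulo l 0 A.
Proof. by exists 0 => [[] | c v _] //; exact: thinmx0. Qed.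

(** [U] stacked on [A] has [L + m] independent rows: [c] vanishes on [U] by assumption, then on [A]
    by regularity. *)
Lemma independent_modulo_leq l L A : regular q0 A -> tdeg_le l A ->
  independent_modulo l L A -> (L <= m * l)%N.
Proof.
move=> regA degA [U degU freeU].
have : (L + m <= m * l.+1)%N; last by rewrite mulnS addnC leq_add2l.
apply: (@free_rows_leq _ _ (col_mx U A)) => [i j k lt_k | c].
  by rewrite mxE; case: split => h; [exact: degU | exact: degA].
rewrite -[c]hsubmxK map_row_mx mul_row_col => eq0.
have cl0 := freeU _ _ eq0; rewrite cl0 map_mx0 mul0mx add0r in eq0 *.
have /matrixP cr0 := regular_free regA eq0.
suff -> : rsubmx c = 0 by rewrite row_mx0.
apply/rowP => j; have := cr0 0 j; rewrite !mxE => /(congr1 (tcoef 0)).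
by rewrite tcoef_const tcoef0.
Qed.

(** The row module of [G *m A] is contained in that of [A], so the same [U] serves. *)
Lemma independent_modulo_mul l L A (G : 'M_m) :
  independent_modulo l L A -> independent_modulo l L (G *m A).
Proof. by move=> [U degU freeU]; exists U => // c v; rewrite mulmxA; exact: freeU. Qed.

(* The last row of A is independent of the row module of the shifted matrix,
   because every multiple of t has t-coefficient 0 in degree 0. *)
Lemma independent_modulo_tshift l L A r s (E : (r + s)%N = m) :
  (0 < s)%N -> regular q0 A -> tdeg_le l A -> independent_modulo l L A ->
  independent_modulo l (1 + L) (tshift q E *m A).
Proof.
move=> s_gt0 regA degA [U degU freeU].
(* The new vector is row [j] of [A], the first of the [s] rows to be shifted. *)
pose j : 'I_m := cast_ord E (rshift r (Ordinal s_gt0)).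
exists (col_mx (row j A) U) => [i k h lt_h | c v].
  by rewrite mxE; case: split => x; rewrite ?mxE; [exact: degA | exact: degU].
rewrite -[c]hsubmxK map_row_mx mul_row_col mulmxA rowE mulmxA.
(* Apart from the part in [U], everything is a row vector times [A]: independence modulo [A] kills
   the right part of [c], and regularity then kills that row vector. *)
set w := map_mx _ (lsubmx c) *m _; rewrite addrAC -mulmxDl addrC => eq0.
have cr0 := freeU _ _ eq0; rewrite cr0 map_mx0 mul0mx add0r in eq0 *.
have /rowP/(_ j) := regular_free regA eq0.
rewrite !mxE big_ord1 !mxE !eqxx mulr1 => /(congr1 (tcoef 0)).
(* At entry [j] the summands of [v *m tshift q E] are zero or left multiples of t, so the
   coefficient of [t^0] isolates [lsubmx c]. *)
rewrite tcoefD tcoef_const tcoef0 tcoef_sum big1 ?addr0 => [cl0 | k _].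
  suff -> : lsubmx c = 0 by rewrite row_mx0.
  by apply/rowP => i; rewrite !ord1 !mxE.
rewrite /tshift /square castmxE /= /j cast_ordK.
case: (split_ordP (cast_ord (esym E) k)) => i ->.
  by rewrite block_mxEur mxE mulr0 tcoef0.
rewrite block_mxEdr mxE; case: eqP => _; first by rewrite tcoefM_t.
by rewrite mulr0n mulr0 tcoef0.
Qed.

(** The lower rows have t-degree below [l], so multiplying them by t stays within the bound and
    leaves the upper block alone. *)
Lemma shift_lead l A r s (E : (r + s)%N = m) (B : 'M_(r, m)) :
  tdeg_le l A -> map_mx (tcoef l) A = stack E B 0 ->
  tdeg_le l (tshift q E *m A) /\
  exists C, map_mx (tcoef l) (tshift q E *m A) = stack E B C.
Proof.
case: m / E A B => A B; rewrite /stack /tshift /square !castmx_id => degA leadA.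
have shiftE : block_mx 1%:M 0 0 (skew_t q)%:M *m A =
    col_mx (usubmx A) (skew_t q *: dsubmx A).
  by rewrite -{1}[A]vsubmxK mul_block_col mul1mx !mul0mx addr0 add0r mul_scalar_mx.
have lowerA i j k : (l <= k)%N -> tcoef k (dsubmx A i j) = 0.
  rewrite leq_eqVlt => /predU1P[<- | lt_k]; last by rewrite mxE degA.
  by have /matrixP/(_ (rshift r i) j) := leadA; rewrite col_mxEd !mxE.
split=> [i j k lt_k | ].
  rewrite shiftE mxE; case: split => h; first by rewrite mxE degA.
  by rewrite mxE tcoef_tM; case: k lt_k => // k lt_k; rewrite lowerA.
exists (map_mx (tcoef l) (skew_t q *: dsubmx A)).
rewrite shiftE map_col_mx; congr col_mx; apply/matrixP => i j.
by have /matrixP/(_ (lshift s i) j) := leadA; rewrite col_mxEu !mxE.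
Qed.

(** * The invariant and its preservation by the steps *)

Section Steps.
Implicit Types A : 'M[skew]_m.

Lemma act_tlead_tdeg_le A l (X : 'M_m) : tdeg_le l A -> tdeg_le l (act_tlead X A).
Proof. exact: tdeg_le_mulK. Qed.

(** The product being nonzero means that the t-degree does not drop. *)
Lemma tlead_act_tlead A (X : 'M_m) : X *m tlead A != 0 ->
  tlead (act_tlead X A) = X *m tlead A.
Proof.
rewrite -(tcoef_act_tlead X A q0) => nz.
have [] // := tlead_tcoef _ nz.
by apply: act_tlead_tdeg_le; exact/tdeg_leP.
Qed.

Lemma equivalent_act_tlead A0 A (X : 'M_m) :
  unimodular X -> equivalent q0 A0 A -> equivalent q0 A0 (act_tlead X A).
Proof.
by move=> uX; apply: equivalent_mul; apply: unimodular_map; exact: unimodular_act.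
Qed.

Lemma regular_tlead_neq0 A : regular q0 A -> \det (tlead A) = 0 -> tlead A != 0.
Proof.
move=> regA det0; apply: contra_eqN det0 => /eqP/tlead_eq0 A0.
(* For [m = 0] the zero matrix is regular, but its determinant is 1. *)
case: (posnP m) => [m0 | m_gt0].
  suff -> : tlead A = 1%:M by rewrite det1 oner_neq0.
  by apply/matrixP => i; have := ltn_ord i; rewrite {2}m0.
have v0 : const_mx 1 = 0 :> 'rV[skew]_m by apply: (regular_free regA); rewrite A0 mulmx0.
by have /rowP/(_ (Ordinal m_gt0)) := v0; rewrite !mxE => /eqP; rewrite oner_eq0.
Qed.

Variables (A0 : 'M[skew]_m) (l : nat).
Hypothesis regA0 : regular q0 A0.

(* n bounds the number of remaining steps: an increment of L, of which there
   are at most m * l by independent_modulo_leq, pays for two of them. *)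
Definition invariant (n : nat) (x : state q m) : Prop :=
  match x with
  | Outer A => [/\ equivalent q0 A0 A, tdeg_le l A &
      exists2 L, independent_modulo l L A & (2 * (m * l) + 2 <= 2 * L + n)%N]
  | Inner r s E B A =>
      [/\ equivalent q0 A0 A, tdeg_le l A &
        exists2 L, independent_modulo l L A & (2 * (m * l) + 1 <= 2 * L + n)%N] /\
      [/\ (0 < s)%N, B != 0 & tlead A = stack E B 0]
  | Return A => equivalent q0 A0 A /\ \det (tlead A) != 0
  end.

(** The bound [L <= m * l] forces [n > 0]. Entering the inner loop costs one unit, matched by the
    offsets 2 and 1; a reduction raises [2 * L] by two, which covers its own unit and the offset of
    a return to [Outer]. *)
Lemma step_invariant x y n : step x y -> invariant n x ->
  exists2 n', n = n'.+1 & invariant n' y.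
Proof.
case=> {x y} [A det_neq0 | A r s E X B det0 rankA uX popB leadXA |
  A r s E B C X Y leadTA defC irrY A'].
- move=> [eqA degA [L indA le_n]].
  have le_L := independent_modulo_leq (regular_equivalent eqA regA0) degA indA.
  by case: n le_n => [|n] le_n; [lia | exists n].
- move=> [eqA degA [L indA le_n]]; have regA := regular_equivalent eqA regA0.
  have le_L := independent_modulo_leq regA degA indA.
  case: n le_n => [|n] le_n; first lia.
  have nz_lead := regular_tlead_neq0 regA det0.
  have nz_XA : X *m tlead A != 0.
    apply: contra_neq nz_lead => XA0; have [V [_ VX]] := uX.
    by rewrite -[tlead A]mul1mx -VX -mulmxA XA0 mulmx0.
  exists n => //; split; first split.
  + exact: equivalent_act_tlead.
  + exact: act_tlead_tdeg_le.
  + by exists L; [exact: independent_modulo_mul | lia].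
  split; last by rewrite tlead_act_tlead.
  + by have := rank_fraction_det0 det0; rewrite -rankA; lia.
  + apply: contraNneq nz_XA => B0; rewrite leadXA B0 /stack; apply/eqP/matrixP => i j.
    by rewrite castmxE mxE; case: split => k; rewrite !mxE.
move=> [[eqA degA [L indA le_n]] [s_gt0 nzB leadA]].
have regA := regular_equivalent eqA regA0.
have le_L := independent_modulo_leq regA degA indA.
case: n le_n => [|n] le_n; first lia.
have eqA' : equivalent q0 A0 A'.
  apply: equivalent_act_tlead; first exact: unimodular_square.
  by apply: equivalent_mul => //; exact: unimodular_tshift.
have degA' : tdeg_le l A'.
  apply: act_tlead_tdeg_le; apply/tdeg_leP.
  (* The t-degree of [A] may be below [l], so [shift_lead] is applied at the exact degree, where the
     zero block is known. *)
  apply: leq_trans ((tdeg_leP _ _).1 degA); apply/tdeg_leP.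
  by have [] := shift_lead (E := E) ((tdeg_leP A _).2 (leqnn _)) leadA.
have indA' : independent_modulo l (1 + L) A'
  by apply: independent_modulo_mul; exact: independent_modulo_tshift.
exists n => //; case: eqP => [Y0 | _]; last first.
  by split=> //; exists (1 + L)%N => //; lia.
split; first by split=> //; exists (1 + L)%N => //; lia.
(* With [Y = 0] the leading matrix returns to [B] over zero; [B != 0] keeps the degree from
   dropping. *)
split=> //; have leadA' : square E 1%:M 0 (- X) 1%:M *m stack E B C = stack E B 0.
  by rewrite stack_reduce defC Y0 addr0 subrr.
by rewrite tlead_act_tlead leadTA leadA' // stack_neq0.
Qed.

Lemma invariant_terminates n x : invariant n x -> terminates x.
Proof.
elim: n x => [|n IHn] x inv_x; constructor=> y st;
  have [n' def_n inv_y] := step_invariant st inv_x.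
  by discriminate def_n.
by apply: IHn; case: def_n => ->.
Qed.

(** No run gets stuck: a Popov form and a division always exist, and [B != 0] ensures that the
    shifted matrix has leading matrix with upper block [B]. *)
Lemma invariant_progress n x : invariant n x ->
  (exists B, x = Return B) \/ (exists y, step x y).
Proof.
case: x => [A _ | r s E B A [_ [s_gt0 nzB leadA]] | A _]; last by left; exists A.
  right; have [det0 | det_neq0] := eqVneq (\det (tlead A)) 0.
    have [r [s [E [X [B [rankA uX popB XA]]]]]] := popov_form (tlead A).
    by exists (Inner E B (act_tlead X A)); apply: StepPopov.
  by exists (Return A); apply: StepReturn.
right; have degA := (tdeg_leP A _).2 (leqnn _).
have [degTA [C leadTA]] := shift_lead degA leadA.
have [X [Y [defC irrY]]] := division B C.
have [_ tleadTA] := tlead_tcoef degTA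
  (eq_ind_r (fun M => M != 0) (stack_neq0 E C nzB) leadTA).
by eexists; apply: (StepReduce (C := C) _ defC irrY); rewrite tleadTA.
Qed.

Lemma reachable_invariant n x y : reachable x y -> invariant n x ->
  exists n', invariant n' y.
Proof.
move=> xy; elim: xy n => {x y} [x y /step_invariant inv n /inv[n' _ inv_y] |
  x n inv_x | x y z _ IHxy _ IHyz n inv_x].
- by exists n'.
- by exists n.
by have [n' /IHyz] := IHxy n inv_x.
Qed.

End Steps.
End Termination.

Theorem theorem4p6 (K : fieldType) (char0 : [pchar K] =i pred0)
    (q : K) (q_neq0 : q != 0) (q_nroot : forall n, (0 < n)%N -> q ^+ n != 1)
    (m : nat) (A : 'M[skewKt q]_m) (regA : regular q_neq0 A) :
  [/\ terminates (Outer A),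
      forall x, reachable (Outer A) x ->
        (exists B, x = Return B) \/ (exists y, step x y)
    & forall B, reachable (Outer A) (Return B) ->
        equivalent q_neq0 A B /\ \det (tlead B) != 0].
Proof.
(* The initial budget is the value of [n] that gives equality at [L = 0]. *)
have inv : invariant q_neq0 A (tdeg A) (2 * (m * tdeg A) + 2) (Outer A).
  split; [exact: equivalent_refl | exact/tdeg_leP | exists 0%N => //].
  exact: independent_modulo0.
split=> [|x reach_x|B reach_B]; first exact: invariant_terminates inv.
  by have [n] := reachable_invariant regA reach_x inv; exact: invariant_progress.
by have [n] := reachable_invariant regA reach_B inv.
Qed.
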